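(* The implication ''if $(X,\tau)$ is connected then $(X,\tau,\mathfrak{a})$ is $\mathfrak{a}$-connected'' cannot be reversed in general: there exist a topological space $(X,\tau)$ and a scope function $\mathfrak{a}$ on $(X,\tau)$ such that $(X,\tau,\mathfrak{a})$ is $\mathfrak{a}$-connected but $(X,\tau)$ is not connected.
   Context: A scope function on a topological space $(X,\tau)$ is a function $\mathfrak{a}:X\to\tau$ such that $x\in\mathfrak{a}(x)$ for every $x\in X$; the triple $(X,\tau,\mathfrak{a})$ is then called an $\mathfrak{a}$-space. A subset $A\subseteq X$ is $\mathfrak{a}$-open if $\mathfrak{a}(x)\subseteq A$ for every $x\in A$; the collection $\tau_{\mathfrak{a}}$ of all $\mathfrak{a}$-open sets is a topology on $X$ with $\tau_{\mathfrak{a}}\subseteq\tau$. The space $(X,\tau,\mathfrak{a})$ is $\mathfrak{a}$-disconnected if there exist nonempty disjoint $U,V\in\tau_{\mathfrak{a}}$ with $X=U\cup V$, and $\mathfrak{a}$-connected if it is not $\mathfrak{a}$-disconnected. *)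

(* Defs.v *)
From mathcomp Require Import all_boot all_order.
From mathcomp Require Import boolp classical_sets topology.

Set Implicit Arguments.
Unset Strict Implicit.
Unset Printing Implicit Defensive.

Local Open Scope classical_set_scope.

Record scope_function (X : topologicalType) := ScopeFunction {
  scope_fun :> X -> set X;
  scope_open : forall x : X, open (scope_fun x);
  scope_mem : forall x : X, scope_fun x x
}.

Definition scope_topology (X : topologicalType) (a : scope_function X) :
    set (set X) :=
  [set A : set X | forall x, A x -> a x `<=` A].

Definition scope_disconnected (X : topologicalType) (a : scope_function X) :
    Prop :=
  exists U V : set X,
    [/\ scope_topology a U, scope_topology a V, U !=set0 /\ V !=set0,
        U `&` V = set0 & [set: X] = U `|` V].

Definition scope_connected (X : topologicalType) (a : scope_function X) :
    Prop :=
  ~ scope_disconnected a.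

Lemma scope_topologyT (X : topologicalType) (a : scope_function X) :
  scope_topology a [set: X].
Proof. by []. Qed.

Lemma scope_topologyI (X : topologicalType) (a : scope_function X)
    (A B : set X) :
  scope_topology a A -> scope_topology a B -> scope_topology a (A `&` B).
Proof. by move=> hA hB x [Ax Bx] y axy; split; [exact: hA axy|exact: hB axy]. Qed.

Lemma scope_topology_bigU (X : topologicalType) (a : scope_function X)
    (I : Type) (D : set I) (F : I -> set X) :
  (forall i, D i -> scope_topology a (F i)) ->
  scope_topology a (\bigcup_(i in D) F i).
Proof. by move=> hF x [i Di Fix_] y axy; exists i => //; exact: hF axy. Qed.

Lemma scope_topology_open (X : topologicalType) (a : scope_function X) :
  scope_topology a `<=` open.
Proof.
move=> A hA; suff -> : A = \bigcup_(x in A) a x.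
  by apply: bigcup_open => x _; exact: scope_open.
apply/seteqP; split=> [x Ax|y [x Ax axy]]; last exact: hA axy.
by exists x => //; exact: scope_mem.
Qed.

(* Main.v *)
Require Import Defs.
From mathcomp Require Import all_boot all_order.
From mathcomp Require Import boolp classical_sets topology.

Local Open Scope classical_set_scope.

(** Taking the whole space as the scope of every point makes the scope topology indiscrete, so
    [scope_connected] holds whatever the original topology is. Any disconnected space then serves;
    here it is discrete [bool]. *)

Definition scope_setT (X : topologicalType) : scope_function X :=
  ScopeFunction (fun _ : X => openT) (fun _ : X => I).

(** A scope-open set with one point contains all points, so it meets every nonempty set. *)
Lemma scope_setT_connected (X : topologicalType) :
  scope_connected (scope_setT X).
Proof.
move=> [U [V [hU _ [[x Ux] [y Vy]] UV0 _]]].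
have : (U `&` V) y by split => //; exact: hU Ux y I.
by rewrite UV0.
Qed.

Lemma bool_not_connected : ~ connected [set: bool].
Proof.
move=> /(_ [set true]) conn.
(* [connected] forces a nonempty clopen set to be everything, but [[set true]] misses [false]. *)
suff /seteqP[_ /(_ false I)] : [set true] = [set: bool] by [].
apply: conn; first by exists true.
- by exists [set true]; [exact: discrete_open|rewrite setTI].
- by exists [set true]; [exact: discrete_closed|rewrite setTI].
Qed.

Theorem theorem4p3 :
  exists (X : topologicalType) (a : scope_function X),
    scope_connected a /\ ~ connected [set: X].
Proof.
exists bool, (scope_setT bool).
by split; [exact: scope_setT_connected|exact: bool_not_connected].
Qed.
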